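(* The class of laminar matroids coincides with the class of matroids that can be constructed by beginning with the empty matroid and using the following operations. (i) Adding a coloop to a previously constructed matroid. (ii) Truncating a previously constructed matroid. (iii) Taking the direct sum of two previously constructed matroids.
   Context: All matroids are finite and classes of matroids are considered closed under isomorphism. A family $\mathcal{A}$ of subsets of a finite set $E$ is laminar if, for all $A,B\in\mathcal{A}$ with $A\cap B\neq\emptyset$, either $A\subseteq B$ or $B\subseteq A$. Given a laminar family $\mathcal{A}$ of subsets of $E$ and a capacity function $c:\mathcal{A}\to\mathbb{Z}_{\ge 0}$, $M(E,\mathcal{A},c)$ is the matroid on $E$ whose independent sets are exactly the sets $I\subseteq E$ with $|I\cap A|\le c(A)$ for all $A\in\mathcal{A}$. A matroid is laminar if it is isomorphic to $M(E,\mathcal{A},c)$ for some finite set $E$, laminar family $\mathcal{A}$ of subsets of $E$, and capacity function $c$. The empty matroid is the matroid on the empty ground set. Adding a coloop to $M$ means forming $M\oplus U_{1,1}$ on $E(M)\cup\{e\}$ with $e\notin E(M)$. Truncating a matroid $M$ with $r(M)>0$ means forming the matroid on $E(M)$ whose independent sets are the independent sets of $M$ of size at most $r(M)-1$. Direct sums are taken of matroids on disjoint ground sets. *)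

(* Defs.v *)
From mathcomp Require Import all_boot.

Set Implicit Arguments.
Unset Strict Implicit.
Unset Printing Implicit Defensive.

(* A finite matroid. The ground set is the whole of a finite type, so that a  *)
(* class of matroids is a predicate on this record.                           *)
Record matroid := Matroid {
  ground :> finType;
  indep : {set {set ground}};
  indep0 : set0 \in indep;
  indepS : forall I J : {set ground}, J \in indep -> I \subset J -> I \in indep;
  indep_aug : forall I J : {set ground}, I \in indep -> J \in indep ->
    #|I| < #|J| -> exists2 x, x \in J :\: I & x |: I \in indep
}.

Definition miso (M N : matroid) : Prop :=
  exists f : M -> N, bijective f /\
    forall I : {set M}, (f @: I \in indep N) = (I \in indep M).

Definition rank (M : matroid) : nat := \max_(I in indep M) #|I|.

Section Uniform.
Variables r n : nat.

Definition uniform_indep : {set {set 'I_n}} := [set I : {set 'I_n} | #|I| <= r].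

Fact uniform_indep0 : set0 \in uniform_indep.
Proof. by rewrite inE cards0. Qed.

Fact uniform_indepS (I J : {set 'I_n}) :
  J \in uniform_indep -> I \subset J -> I \in uniform_indep.
Proof. by rewrite !inE => Jr /subset_leq_card IJ; apply: leq_trans IJ Jr. Qed.

Fact uniform_indep_aug (I J : {set 'I_n}) :
  I \in uniform_indep -> J \in uniform_indep -> #|I| < #|J| ->
  exists2 x, x \in J :\: I & x |: I \in uniform_indep.
Proof.
rewrite !inE => _ Jr ltIJ.
have /subsetPn[x xJ xI] : ~~ (J \subset I).
  by apply/negP => /subset_leq_card; rewrite leqNgt ltIJ.
exists x; first by rewrite inE xI.
by rewrite inE cardsU1 xI; apply: leq_trans ltIJ Jr.
Qed.

Definition uniform : matroid :=
  Matroid uniform_indep0 uniform_indepS uniform_indep_aug.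

End Uniform.

Section DirectSum.
Variables M N : matroid.

Definition dsum_indep : {set {set (M + N)%type}} :=
  [set I : {set (M + N)%type} |
    (inl @^-1: I \in indep M) && (inr @^-1: I \in indep N)].

Fact dsum_indep0 : set0 \in dsum_indep.
Proof. by rewrite inE !preimset0 !indep0. Qed.

Fact dsum_indepS (I J : {set (M + N)%type}) :
  J \in dsum_indep -> I \subset J -> I \in dsum_indep.
Proof.
rewrite !inE => /andP[JM JN] IJ.
by rewrite (indepS JM (preimsetS _ IJ)) (indepS JN (preimsetS _ IJ)).
Qed.

Let card_dsum (I : {set (M + N)%type}) :
  #|I| = #|inl @^-1: I| + #|inr @^-1: I|.
Proof.
rewrite -!sum1_card big_sumType /=.
by congr (_ + _); apply: eq_bigl => x; rewrite inE.
Qed.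

Fact dsum_indep_aug (I J : {set (M + N)%type}) :
  I \in dsum_indep -> J \in dsum_indep -> #|I| < #|J| ->
  exists2 x, x \in J :\: I & x |: I \in dsum_indep.
Proof.
rewrite !inE => /andP[IM IN] /andP[JM JN].
rewrite (card_dsum I) (card_dsum J) => ltIJ.
case: (ltnP #|inl @^-1: I| #|inl @^-1: J|) => [ltM|leM].
  have [x xJI xI] := indep_aug IM JM ltM.
  exists (inl x); first by move: xJI; rewrite !inE.
  rewrite inE; apply/andP; split.
    rewrite (_ : _ @^-1: _ = x |: inl @^-1: I) //.
    by apply/setP => y; rewrite !inE.
  rewrite (_ : _ @^-1: _ = inr @^-1: I) //.
  by apply/setP => y; rewrite !inE.
have ltN : #|inr @^-1: I| < #|inr @^-1: J| by
  rewrite ltnNge; apply: contraL ltIJ => leN; rewrite -leqNgt leq_add.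
have [x xJI xI] := indep_aug IN JN ltN.
exists (inr x); first by move: xJI; rewrite !inE.
rewrite inE; apply/andP; split.
  rewrite (_ : _ @^-1: _ = inl @^-1: I) //.
  by apply/setP => y; rewrite !inE.
rewrite (_ : _ @^-1: _ = x |: inr @^-1: I) //.
by apply/setP => y; rewrite !inE.
Qed.

Definition dsum : matroid := Matroid dsum_indep0 dsum_indepS dsum_indep_aug.

End DirectSum.

Definition add_coloop (M : matroid) : matroid := dsum M (uniform 1 1).

Section Truncation.
Variable M : matroid.

(* [(rank M).-1] is [r(M) - 1] only when [0 < rank M]; for [rank M = 0] this  *)
(* is [M] itself, and [constructible] only truncates matroids of positive     *)
(* rank.                                                                      *)
Definition trunc_indep : {set {set M}} :=
  [set I in indep M | #|I| <= (rank M).-1].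

Fact trunc_indep0 : set0 \in trunc_indep.
Proof. by rewrite inE indep0 cards0. Qed.

Fact trunc_indepS (I J : {set M}) :
  J \in trunc_indep -> I \subset J -> I \in trunc_indep.
Proof.
rewrite !inE => /andP[JM Jr] IJ; rewrite (indepS JM IJ) /=.
exact: leq_trans (subset_leq_card IJ) Jr.
Qed.

Fact trunc_indep_aug (I J : {set M}) :
  I \in trunc_indep -> J \in trunc_indep -> #|I| < #|J| ->
  exists2 x, x \in J :\: I & x |: I \in trunc_indep.
Proof.
rewrite !inE => /andP[IM _] /andP[JM Jr] ltIJ.
have [x xJI xIM] := indep_aug IM JM ltIJ; exists x; first exact: xJI.
move: xJI; rewrite !in_setD => /andP[xI _].
by rewrite inE xIM cardsU1 xI /= add1n (leq_trans ltIJ Jr).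
Qed.

Definition trunc : matroid := Matroid trunc_indep0 trunc_indepS trunc_indep_aug.

End Truncation.

Definition laminar_family (E : finType) (F : {set {set E}}) : Prop :=
  forall A B : {set E}, A \in F -> B \in F -> A :&: B != set0 ->
    A \subset B \/ B \subset A.

Section LaminarMatroid.
Variables (E : finType) (F : {set {set E}}) (c : {set E} -> nat).
Hypothesis lamF : laminar_family F.

(* The capacity function is total on [{set E}], but only its values on the    *)
(* members of [F] are used.                                                   *)
Definition lam_indep : {set {set E}} :=
  [set I : {set E} | [forall A in F, #|I :&: A| <= c A]].

Fact lam_indep0 : set0 \in lam_indep.
Proof. by rewrite inE; apply/forall_inP => A _; rewrite set0I cards0. Qed.

Fact lam_indepS (I J : {set E}) :
  J \in lam_indep -> I \subset J -> I \in lam_indep.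
Proof.
rewrite !inE => /forall_inP Jc IJ; apply/forall_inP => A AF.
exact: leq_trans (subset_leq_card (setSI A IJ)) (Jc A AF).
Qed.

Fact lam_indep_aug (I J : {set E}) :
  I \in lam_indep -> J \in lam_indep -> #|I| < #|J| ->
  exists2 x, x \in J :\: I & x |: I \in lam_indep.
Proof.
rewrite !inE => /forall_inP Ic /forall_inP Jc ltIJ; apply/exists_inP.
apply: contraLR ltIJ => /exists_inPn noaug; rewrite -leqNgt.
pose tight (A : {set E}) := (A \in F) && (#|I :&: A| == c A).
pose S := [set A : {set E} | maxset tight A].
have tightS A : A \in S -> tight A by rewrite inE => /maxsetp.
have trivS : trivIset S.
  apply/trivIsetP => A B AS BS neqAB; apply/negPn/negP => AB.
  have [/andP[AF _] /andP[BF _]] := (tightS A AS, tightS B BS).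
  have AB0 : A :&: B != set0 by rewrite setI_eq0.
  move: (AS) (BS); rewrite !inE => /maxsetP[tA mA] /maxsetP[tB mB].
  case: (lamF AF BF AB0) => [sAB|sBA].
    by rewrite (mA B tB sAB) eqxx in neqAB.
  by rewrite (mB A tA sBA) eqxx in neqAB.
have out : J :\: cover S \subset I :\: cover S.
  apply/subsetP => x; rewrite !inE => /andP[xS xJ]; rewrite xS /=.
  apply: contraR xS => xI.
  have /noaug : x \in J :\: I by rewrite inE xI.
  rewrite inE => /forall_inPn[A AF]; rewrite -ltnNge => ltA.
  have xA : x \in A.
    apply: contraLR ltA => xA; rewrite -leqNgt.
    rewrite (_ : (x |: I) :&: A = I :&: A) ?Ic //.
    apply/setP => y; rewrite !inE; case: eqP => // ->.
    by rewrite (negPf xA) !andbF.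
  have tA : tight A.
    rewrite /tight AF /= eqn_leq Ic //=.
    move: ltA; rewrite setIUl (_ : [set x] :&: A = [set x]); last first.
      by apply/setIidPl; rewrite sub1set.
    by rewrite cardsU1 !inE (negPf xI).
  have [B mB sAB] := maxset_exists tA.
  by apply/bigcupP; exists B; rewrite ?inE // (subsetP sAB).
have cardS (K : {set E}) : #|K :&: cover S| = \sum_(A in S) #|K :&: A|.
  rewrite -sum1_card (eq_bigl (fun x => (x \in cover S) && (x \in K))); last first.
    by move=> x; rewrite inE andbC.
  rewrite big_trivIset_cond //; apply: eq_bigr => A _.
  by rewrite -sum1_card; apply: eq_bigl => x; rewrite inE andbC.
rewrite -(cardsID (cover S) J) -(cardsID (cover S) I).
apply: leq_add (subset_leq_card out); rewrite !cardS.
by apply: leq_sum => A /tightS/andP[AF /eqP->]; apply: Jc.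
Qed.

Definition lam_matroid : matroid := Matroid lam_indep0 lam_indepS lam_indep_aug.

End LaminarMatroid.

Definition is_laminar (M : matroid) : Prop :=
  exists (E : finType) (F : {set {set E}}) (c : {set E} -> nat)
    (lamF : laminar_family F), miso M (lam_matroid c lamF).

(* [constructible_iso] records that classes of matroids are closed under      *)
(* isomorphism.                                                               *)
Inductive constructible : matroid -> Prop :=
| constructible_empty (M : matroid) : #|M| = 0 -> constructible M
| constructible_iso (M N : matroid) : miso M N -> constructible M -> constructible N
| constructible_coloop (M : matroid) : constructible M -> constructible (add_coloop M)
| constructible_trunc (M : matroid) : 0 < rank M -> constructible M ->
    constructible (trunc M)
| constructible_dsum (M N : matroid) : constructible M -> constructible N ->
    constructible (dsum M N).

(* Main.v *)
Require Import Defs.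
From mathcomp Require Import all_boot.

(** A family on at least two points has a proper nonempty set A (a maximal
    proper member, or a singleton) such that every member other than the ground
    set lies in A or in its complement. Without the constraint of the ground set
    itself, the matroid is therefore the direct sum of its restrictions to A and
    to the complement; that remaining constraint is an iterated truncation.
    Induction on the size of the ground set builds every laminar matroid.
    Conversely, a truncation only adds the ground set to a laminar family, and a
    direct sum takes the union of two families on disjoint sets. *)

Set Implicit Arguments.
Unset Strict Implicit.
Unset Printing Implicit Defensive.

(** * Isomorphisms and transport of laminar families *)

Lemma miso_sym (M N : matroid) : miso M N -> miso N M.
Proof.
case=> f [[g fK gK] fI]; exists g; split; first by exists f.
move=> I; rewrite -fI -imset_comp (eq_imset (g := id)) ?imset_id //.
Qed.

Lemma miso_trans (M N P : matroid) : miso M N -> miso N P -> miso M P.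
Proof.
move=> [f [bf fI]] [g [bg gI]]; exists (g \o f); split; first exact: bij_comp.
by move=> I; rewrite imset_comp gI fI.
Qed.

Lemma card_setI_imset (T U : finType) (f : T -> U) (J : {set U}) (D : {set T}) :
  injective f -> #|J :&: f @: D| = #|f @^-1: J :&: D|.
Proof.
move=> f_inj; rewrite -(card_imset _ f_inj); apply: eq_card => y.
apply/setIP/imsetP => [[yJ /imsetP[x xD eqy]] | [x]].
  by exists x; rewrite // !inE -eqy yJ.
by rewrite !inE => /andP[xJ xD] ->; rewrite imset_f.
Qed.

Lemma lam_indepP (E : finType) (F : {set {set E}}) (c : {set E} -> nat)
    (I : {set E}) :
  reflect (forall A, A \in F -> #|I :&: A| <= c A) (I \in lam_indep F c).
Proof. by rewrite inE; apply: forall_inP. Qed.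

Lemma card_le_rank (M : matroid) (I : {set M}) : I \in indep M -> #|I| <= rank M.
Proof. by move=> IM; rewrite /rank (bigmax_sup I). Qed.

(** Only members of [F] inside the range of [f] are kept. For a bijection this transports the whole
    family; for the inclusion of a subset it keeps the members contained in that subset. *)
Definition pull_family (T E : finType) (f : T -> E) (F : {set {set E}}) :
  {set {set T}} := [set D : {set T} | f @: D \in F].

Lemma laminar_pull (T E : finType) (f : T -> E) (F : {set {set E}}) :
  injective f -> laminar_family F -> laminar_family (pull_family f F).
Proof.
move=> f_inj lamF A B; rewrite !inE => AF BF AB.
have ABf : f @: A :&: f @: B != set0.
  by rewrite -imsetI ?imset_eq0 // => x y _ _; apply: f_inj.
have sub (C D : {set T}) : f @: C \subset f @: D -> C \subset D.
  move=> /subsetP CD; apply/subsetP => x xC.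
  by rewrite -(mem_imset _ _ f_inj) CD // mem_imset.
by case: (lamF _ _ AF BF ABf) => /sub; [left | right].
Qed.

(** Pulling the family and its capacities back along the isomorphism puts them on the ground set of
    [M], so that two matroids need no renaming before their families are combined. *)
Lemma is_laminarP (M : matroid) :
  is_laminar M <-> exists (F : {set {set M}}) (c : {set M} -> nat),
    laminar_family F /\ indep M = lam_indep F c.
Proof.
split=> [[E [F [c [lamF [f [bf fI]]]]]] | [F [c [lamF eqM]]]].
  have f_inj := bij_inj bf.
  exists (pull_family f F), (fun D : {set M} => c (f @: D)).
  split; first exact: laminar_pull.
  have cardf (I D : {set M}) : #|f @: I :&: f @: D| = #|I :&: D|.
    by rewrite -imsetI ?card_imset // => x y _ _; apply: f_inj.
  apply/setP => I; rewrite -fI; apply/lam_indepP/lam_indepP => Ic.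
    by move=> D; rewrite inE => /Ic; rewrite cardf.
  move=> A; case: bf => g fK gK.
  have <- : f @: (g @: A) = A.
    by rewrite -imset_comp (eq_imset (g := id)) ?imset_id.
  by move=> AF; rewrite cardf; apply: Ic; rewrite inE.
exists M, F, c, lamF, id; split; first by exists id.
by move=> I; rewrite imset_id eqM.
Qed.

(** * Constructible matroids are laminar *)

Lemma free_laminar (M : matroid) : [set: M] \in indep M -> is_laminar M.
Proof.
move=> MT; apply/is_laminarP; exists set0, (fun=> 0); split.
  by move=> A B; rewrite inE.
apply/setP => I; rewrite (indepS MT) ?subsetT //.
by apply/esym/lam_indepP => A; rewrite inE.
Qed.

Lemma trunc_laminar (M : matroid) : is_laminar M -> is_laminar (trunc M).
Proof.
move=> /is_laminarP[F [c [lamF eqM]]]; apply/is_laminarP.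
exists (setT |: F), (fun A => if A == setT then (rank M).-1 else c A); split.
  move=> A B; rewrite !inE => /orP[/eqP-> | AF] /orP[/eqP-> | BF].
  - by left.
  - by right; apply: subsetT.
  - by left; apply: subsetT.
  - exact: lamF.
apply/setP => I; rewrite inE eqM; apply/andP/lam_indepP.
  case=> /lam_indepP Ic Ir A; rewrite !inE; case: eqP => [-> _ | _].
    by rewrite setIT.
  exact: Ic.
move=> Ic; have Ir : #|I| <= (rank M).-1.
  by have := Ic setT; rewrite !inE eqxx setIT => ->.
split=> //; apply/lam_indepP => A AF.
have := Ic A; rewrite !inE AF orbT; case: eqP => [eqA _ | _ ->] //.
(* If [setT] was already in [F], its old capacity has been overwritten; the old bound survives
   because [c setT] bounds every independent set, hence [rank M]. *)
rewrite eqA in AF *; rewrite setIT (leq_trans Ir) // (leq_trans (leq_pred _)) //.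
apply/bigmax_leqP => J; rewrite eqM => /lam_indepP/(_ _ AF).
by rewrite setIT.
Qed.

Section DirectSum.
Variables M N : matroid.

Let preim_inll (A : {set M}) :
  inl @^-1: (inl @: A : {set (M + N)%type}) = A.
Proof. by apply/setP => x; rewrite inE mem_imset //; apply: inl_inj. Qed.

Let preim_inrr (B : {set N}) :
  inr @^-1: (inr @: B : {set (M + N)%type}) = B.
Proof. by apply/setP => x; rewrite inE mem_imset //; apply: inr_inj. Qed.

Let preim_inrl (A : {set M}) :
  inr @^-1: (inl @: A : {set (M + N)%type}) = set0.
Proof. by apply/setP => x; rewrite !inE; apply/imsetP => -[]. Qed.

Let card_inl (I : {set (M + N)%type}) (A : {set M}) :
  #|I :&: inl @: A| = #|inl @^-1: I :&: A|.
Proof. exact: card_setI_imset inl_inj. Qed.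

Let card_inr (I : {set (M + N)%type}) (B : {set N}) :
  #|I :&: inr @: B| = #|inr @^-1: I :&: B|.
Proof. exact: card_setI_imset inr_inj. Qed.

Lemma dsum_laminar : is_laminar M -> is_laminar N -> is_laminar (dsum M N).
Proof.
move=> /is_laminarP[F [c [lamF eqM]]] /is_laminarP[G [d [lamG eqN]]].
apply/is_laminarP.
pose il (A : {set M}) : {set (M + N)%type} := inl @: A.
pose ir (B : {set N}) : {set (M + N)%type} := inr @: B.
have disj A B : il A :&: ir B = set0.
  by apply/eqP; rewrite -cards_eq0 card_inr preim_inrl set0I cards0.
exists (il @: F :|: ir @: G).
(* The images of the empty set on both sides coincide, but the constraint of
   the empty set is void. *)
exists (fun C : {set (M + N)%type} => if inr @^-1: C == set0 then c (inl @^-1: C)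
                 else d (inr @^-1: C)); split.
  move=> _ _ /setUP[/imsetP[A AF ->] | /imsetP[A AG ->]]
             /setUP[/imsetP[B BF ->] | /imsetP[B BG ->]].
  - rewrite -cards_eq0 card_inl preim_inll cards_eq0 => /(lamF _ _ AF BF).
    by case=> AB; [left | right]; apply: imsetS.
  - by rewrite disj eqxx.
  - by rewrite setIC disj eqxx.
  - rewrite -cards_eq0 card_inr preim_inrr cards_eq0 => /(lamG _ _ AG BG).
    by case=> AB; [left | right]; apply: imsetS.
apply/setP => I; rewrite inE eqM eqN; apply/andP/lam_indepP.
  case=> /lam_indepP Ic /lam_indepP Id.
  move=> _ /setUP[/imsetP[A AF ->] | /imsetP[B BG ->]].
    by rewrite card_inl preim_inrl eqxx preim_inll Ic.
  rewrite card_inr preim_inrr; case: eqP => [-> | _]; last exact: Id.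
  by rewrite setI0 cards0.
move=> Icd; split; apply/lam_indepP.
  move=> A AF; have /Icd : il A \in il @: F :|: ir @: G.
    by rewrite inE imset_f.
  by rewrite card_inl preim_inrl eqxx preim_inll.
move=> B BG; have /Icd : ir B \in il @: F :|: ir @: G.
  by rewrite inE orbC imset_f.
rewrite card_inr preim_inrr; case: eqP => // -> _.
by rewrite setI0 cards0.
Qed.

End DirectSum.

Lemma constructible_laminar (M : matroid) : constructible M -> is_laminar M.
Proof.
elim=> {M} [M M0 | M N MN _ [E [F [c [lamF ML]]]] | M _ lamM | M _ _ | M N _ + _].
- apply: free_laminar; suff -> : [set: M] = set0 by exact: indep0.
  by apply/eqP; rewrite -cards_eq0 cardsT M0.
- by exists E, F, c, lamF; apply: miso_trans ML; apply: miso_sym.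
- apply: dsum_laminar => //; apply: free_laminar.
  by rewrite inE cardsT card_ord.
- exact: trunc_laminar.
- exact: dsum_laminar.
Qed.

(** * Laminar matroids are constructible *)

(** Truncating one step at a time brings the rank down to [k]; the induction is on [rank M - k].
    Once the rank is at most [k], the size bound is void and [f] is an isomorphism. *)
Lemma constructible_truncate (k : nat) (M N : matroid) (f : M -> N) :
    bijective f ->
    (forall I : {set M},
      (f @: I \in indep N) = (I \in indep M) && (#|I| <= k)) ->
  constructible M -> constructible N.
Proof.
have [n] := ubnP (rank M - k); elim: n M f => // n IHn M f ltn bf fI cM.
have [leMk | ltkM] := leqP (rank M) k.
  apply: constructible_iso cM; exists f; split=> // I; rewrite fI.
  by case IM: (I \in indep M) => //=; rewrite (leq_trans (card_le_rank IM) leMk).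
have M0 : 0 < rank M by apply: leq_ltn_trans ltkM.
have rT : rank (trunc M) <= (rank M).-1.
  by apply/bigmax_leqP => I; rewrite inE => /andP[].
apply: (IHn (trunc M) f) (constructible_trunc M0 cM) => //.
  apply: leq_ltn_trans (leq_sub2r k rT) _; rewrite -ltnS; apply: leq_trans ltn.
  by rewrite ltnS -subn1 subnAC subn1 ltn_predL subn_gt0.
(* Since [k < rank M], one truncation loses no independent set of size at most [k]. *)
move=> I; rewrite fI inE -andbA; congr (_ && _).
apply/idP/andP => [Ik | [] //]; split=> //; apply: leq_trans Ik _.
by rewrite -ltnS prednK.
Qed.

Lemma laminar_subfamily (E : finType) (F G : {set {set E}}) :
  G \subset F -> laminar_family F -> laminar_family G.
Proof. by move=> /subsetP GF lamF A B /GF AF /GF BF; apply: lamF. Qed.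

Lemma laminar_split (E : finType) (F : {set {set E}}) :
    laminar_family F -> setT \notin F -> 1 < #|E| ->
  exists A : {set E}, [/\ A != set0, A != setT &
    forall C, C \in F -> C \subset A \/ C \subset ~: A].
Proof.
move=> lamF FT E1.
have [/existsP[B PB] | noB] := boolP [exists B in F, B != set0].
  have [A /maxsetP[/andP[AF A0] maxA] _] :=
    maxset_exists (P := fun B => (B \in F) && (B != set0)) PB.
  exists A; split=> // [|C CF]; first by apply: contraNneq FT => <-.
  have [CA | CA] := eqVneq (C :&: A) set0.
    by right; rewrite -disjoints_subset -setI_eq0 CA.
  (* A member meeting [A] is nested with it, and one that contains [A] equals [A] by maximality. *)
  left; case: (lamF _ _ CF AF CA) => // AC; rewrite (maxA C) // CF.
  by apply: contraNneq CA => ->; rewrite set0I.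
(* Every member is now empty, so any singleton separates; it is proper because [E] has at least two
   points. *)
have /card_gt0P[x _] : 0 < #|E| by apply: ltnW.
exists [set x]; split=> [||C CF].
- by rewrite -cards_eq0 cards1.
- by apply: contraTneq E1 => xT; rewrite -cardsT -xT cards1.
- left; move/exists_inPn: noB => /(_ C CF); rewrite negbK => /eqP->.
  exact: sub0set.
Qed.

(** A base case of the induction: one coloop added to the empty matroid. *)
Lemma constructible_free1 (M : matroid) :
  #|M| = 1 -> [set: M] \in indep M -> constructible M.
Proof.
move=> M1 MT.
have c0 : constructible (uniform 0 0) by apply: constructible_empty; rewrite card_ord.
apply: constructible_iso (constructible_coloop c0).
have [x _] : exists x : M, x \in M by apply/card_gt0P; rewrite M1.
have card1 : #|add_coloop (uniform 0 0)| = 1 by rewrite card_sum !card_ord.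
exists (fun=> x); split.
  apply: inj_card_bij; last by rewrite M1 card1.
  move=> y z _; have /card_le1_eqP : #|add_coloop (uniform 0 0)| <= 1 by rewrite card1.
  by apply.
move=> I; rewrite (indepS MT) ?subsetT // inE; symmetry; apply/andP; split.
  by rewrite inE (leq_trans (max_card _)) ?card_ord.
by rewrite inE (leq_trans (max_card _)) ?card_ord.
Qed.

Lemma lam_matroid_constructible (E : finType) (F : {set {set E}})
  (c : {set E} -> nat) (lamF : laminar_family F) :
  constructible (lam_matroid c lamF).
Proof.
have [n] := ubnP #|E|; elim: n E F c lamF => // n IHn E F c lamF ltEn.
pose F' := F :\ setT; have sF'F : F' \subset F by apply: subsetDl.
have lamF' := laminar_subfamily sF'F lamF.
suff cF' : constructible (lam_matroid c lamF').
  (* The bound [#|E|] is void, which covers the case where [F] does not constrain the whole ground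
     set. *)
  apply: (@constructible_truncate (if setT \in F then c setT else #|E|)
    (lam_matroid c lamF') (lam_matroid c lamF) id _ _ cF'); first by exists id.
  move=> I; rewrite imset_id; apply/lam_indepP/andP => [Ic | [/lam_indepP Ic Ik]].
    split; first by apply/lam_indepP => A /(subsetP sF'F)/Ic.
    case: ifP => [/Ic | _]; first by rewrite setIT.
    exact: max_card.
  move=> A AF; have [eqA | AT] := eqVneq A setT; last by apply: Ic; rewrite !inE AT.
  by move: AF Ik; rewrite eqA setIT => ->.
have F'T : setT \notin F' by rewrite !inE eqxx.
have [le1E | gt1E] := leqP #|E| 1.
  have [E0 | E0] := posnP #|E|; first exact: constructible_empty.
  have E1 : #|E| = 1 by apply/eqP; rewrite eqn_leq le1E.
  (* On one point a proper member is empty, so [F'] imposes no constraint. *)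
  apply: constructible_free1 => //; apply/lam_indepP => A.
  rewrite setTI !inE eqEcard subsetT cardsT E1 /= -ltnNge ltnS.
  by rewrite leqn0 => /andP[/eqP->].
have [A [A0 AT sepA]] := laminar_split lamF' F'T gt1E.
pose val_of (B : {set E}) (x : {x | x \in B}) := val x.
pose restr (B : {set E}) :=
  lam_matroid (fun D : {set {x | x \in B}} => c (@val_of B @: D))
              (laminar_pull (@val_inj _ _ _ : injective (@val_of B)) lamF').
have cR (B : {set E}) : B != setT -> constructible (restr B).
  move=> BT; apply: IHn; rewrite card_sig -ltnS; apply: leq_trans ltEn.
  rewrite ltnS -cardsT; apply: proper_card; rewrite properE subsetT /=.
  by apply: contra BT; rewrite -subTset.
have AcT : ~: A != setT by apply: contra A0 => /eqP eqA; rewrite -[A]setCK eqA setCT.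
apply: constructible_iso (constructible_dsum (cR A AT) (cR _ AcT)).
pose f (u : dsum (restr A) (restr (~: A))) : E :=
  match u with inl x => val x | inr y => val y end.
have f_inj : injective f.
  case=> x [] y /= eqxy.
  - exact: (congr1 inl (val_inj eqxy)).
  (* The mixed cases would put one point both in [A] and in its complement. *)
  - by move: (svalP y); rewrite -[sval y]eqxy inE (svalP x).
  - by move: (svalP x); rewrite [sval x]eqxy inE (svalP y).
  - exact: (congr1 inr (val_inj eqxy)).
exists f; split.
  apply: inj_card_bij f_inj _; rewrite card_sum !card_sig.
  rewrite -(cardsC A) leq_eqVlt; apply/orP; left; apply/eqP.
  by congr (_ + _); apply: eq_card.
move=> I.
have preiml : @val_of A @^-1: (f @: I) = inl @^-1: I.
  by apply/setP => x; rewrite !inE -(mem_imset _ _ f_inj).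
have preimr : @val_of (~: A) @^-1: (f @: I) = inr @^-1: I.
  by apply/setP => x; rewrite !inE -(mem_imset _ _ f_inj).
(* A member inside [B] is the image of its own pullback, so its constraint reappears in [restr B]
   with the same capacity. By [sepA] this accounts for every member of [F']. *)
have pullK (B C : {set E}) : C \subset B -> @val_of B @: (@val_of B @^-1: C) = C.
  move=> /subsetP CB; apply/setP => x; apply/imsetP/idP => [[y] | xC].
    by rewrite inE => yC ->.
  by exists (Sub x (CB x xC)); rewrite ?inE /val_of ?SubK.
have cardv (B : {set E}) (D : {set {x | x \in B}}) :
    #|f @: I :&: @val_of B @: D| = #|@val_of B @^-1: (f @: I) :&: D|.
  exact: card_setI_imset val_inj.
rewrite [RHS]inE -preiml -preimr.
apply/lam_indepP/andP => [Ic | [/lam_indepP Il /lam_indepP Ir] C CF].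
  by split; apply/lam_indepP => D; rewrite inE -cardv => /Ic.
case: (sepA C CF) => sC; rewrite -(pullK _ _ sC) cardv.
  by apply: Il; rewrite inE pullK.
by apply: Ir; rewrite inE pullK.
Qed.

Theorem theorem1p5 (M : matroid) : is_laminar M <-> constructible M.
Proof.
split=> [[E [F [c [lamF ML]]]] | ]; last exact: constructible_laminar.
apply: constructible_iso (miso_sym ML) _.
exact: lam_matroid_constructible.
Qed.
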